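(* Let $n\in\mathbb{N}$ and $\varepsilon>0$ be given. If $n\geqslant 2$ and $\varepsilon<\frac{1}{32n}$, then every connected compact unitary group $\mathcal{G}\subseteq M_n(\mathbb{C})$ with a weak $\varepsilon$-approximate fixed point has a common eigenvector.
   Context: A unitary group $\mathcal{G}\subseteq M_n(\mathbb{C})$ is a group of unitary $n\times n$ complex matrices. $\mathbb{C}^n$ carries the standard inner product and $\|\cdot\|$ is the Euclidean norm. For $0<\varepsilon<1$, a vector $\xi\in\mathbb{C}^n$ with $\|\xi\|=1$ is a weak $\varepsilon$-approximate fixed point of $\mathcal{G}$ if $|\langle G\xi,\xi\rangle|\geqslant 1-\varepsilon$ for all $G\in\mathcal{G}$. A common eigenvector of $\mathcal{G}$ is a vector $\eta$ with $\|\eta\|=1$ such that for every $G\in\mathcal{G}$ there is a scalar $\lambda\in\mathbb{C}$ with $G\eta=\lambda\eta$. *)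

(* Defs.v *)
From HB Require Import structures.
From mathcomp Require Import all_boot all_order all_algebra.
From mathcomp Require Import sesquilinear spectral.
From mathcomp Require Import complex.
From mathcomp Require Import all_classical all_reals topology normedtype.

Set Implicit Arguments.
Unset Strict Implicit.
Unset Printing Implicit Defensive.

Import Order.TTheory GRing.Theory Num.Theory.
Import numFieldNormedType.Exports.

Local Open Scope classical_set_scope.
Local Open Scope ring_scope.
Local Open Scope complex_scope.

(* R[i] gets the topology of the modulus, as a normed space over itself;
   matrices over R[i] then carry the topology of entrywise convergence. *)
HB.instance Definition _ (R : realType) :=
  PseudoPointedMetric.copy R[i] (R[i])^o.
HB.instance Definition _ (R : realType) := NormedModule.copy R[i] (R[i])^o.

Section UnitaryGroups.
Variables (R : realType) (n : nat).
Implicit Types (GG : set 'M[R[i]]_n) (u v xi eta : 'cV[R[i]]_n).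

(* [dotmx] is the standard inner product on row vectors, linear in its first
   argument and conjugate-linear in the second; vectors of C^n are columns. *)
Definition cdot u v : R[i] := dotmx u^T v^T.

Lemma cdotE u v : cdot u v = \sum_(k < n) u k 0 * Num.conj (v k 0).
Proof.
by rewrite /cdot dotmxE !mxE; apply: eq_bigr => k _; rewrite !mxE.
Qed.

Definition cnorm u : R[i] := sqrtC (cdot u u).

Definition unitary_group GG : Prop :=
  [/\ forall G, GG G -> G \is unitarymx,
      GG 1%:M,
      forall G H, GG G -> GG H -> GG (G *m H)
    & forall G, GG G -> GG (invmx G)].

(* The order on R[i] holds only between numbers with equal imaginary parts,
   and the modulus is real, so this inequality is the one between reals. *)
Definition weak_approx_fixed_point (eps : R) GG xi : Prop :=
  cnorm xi = 1 /\
  forall G, GG G -> (1 - eps)%:C <= `|cdot (G *m xi) xi|.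

Definition is_common_eigenvector GG eta : Prop :=
  cnorm eta = 1 /\
  forall G, GG G -> exists lambda : R[i], G *m eta = lambda *: eta.

End UnitaryGroups.

(* Main.v *)
Require Import Defs.
From mathcomp Require Import all_boot all_order all_algebra.
From mathcomp Require Import sesquilinear spectral.
From mathcomp Require Import complex.
From mathcomp Require Import ring lra.
From mathcomp Require Import all_classical all_reals topology normedtype.
From mathcomp Require Import derive.

Set Implicit Arguments.
Unset Strict Implicit.
Unset Printing Implicit Defensive.

Import Order.TTheory GRing.Theory Num.Theory.
Import numFieldNormedType.Exports.

Local Open Scope classical_set_scope.
Local Open Scope ring_scope.
Local Open Scope sesquilinear_scope.

(** Let xi be the weak approximate fixed point, P = xi xi^* the projection onto
    its line and c = (1 - eps)^2.  Consider the set K of all matrices X with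
    Re <X v, v> >= c for every v in the orbit of xi.  It contains P, because
    <P (G xi), G xi> = |<G xi, xi>|^2 >= c.  It is closed and convex, so it has
    a unique element Q of least Frobenius norm ([frob_halfspaces_least]), and
    |Q| <= |P| = 1.  The orbit is stable under the group, so K is stable under
    conjugation by group elements; it is also stable under the adjoint, and
    all these maps preserve the norm.  By uniqueness Q is Hermitian and
    commutes with the group ([invariant_operator]).  Minimizing a norm over K
    thus replaces an average of the projections G P G^* over Haar measure.

    Diagonalize Q in an orthonormal basis, with eigenvalues d_k, and let p_k be
    the squared moduli of the coordinates of xi.  The p_k sum to 1 and the sum
    of the d_k p_k is at least c, so some d_k is at least c.  The squares of the
    eigenvalues sum to |Q|^2 <= 1 < 2 c^2, so no other eigenvalue equals d_k
    ([isolated_eigenvalue]).  The eigenspace of d_k is therefore a line, which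
    everything that commutes with Q preserves ([commutant_eigenvector]).  The
    inequality 1 < 2 c^2 holds because n >= 2 and eps < 1 / (32 n) give
    eps < 1/64. *)

(** * Least-norm points of intersections of half-spaces *)

Section HalfSpaces.
Variables (R : realType) (m : nat).
Implicit Types (u v w : 'rV[R]_m) (W : set 'rV[R]_m) (c : R).

Definition rdot u v : R := \sum_k u 0 k * v 0 k.

Lemma continuous_rdot (f g : 'rV[R]_m -> 'rV[R]_m) :
  continuous f -> continuous g -> continuous (fun v => rdot (f v) (g v)).
Proof.
move=> cf cg; apply: continuous_big => [|k _ v]; first exact: add_continuous.
apply: (@continuousM _ _ (fun v => f v 0 k) (fun v => g v 0 k)).
  apply: (@continuous_comp _ _ _ f (fun x => x 0 k)); first exact: cf.
  exact: coord_continuous.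
apply: (@continuous_comp _ _ _ g (fun x => x 0 k)); first exact: cg.
exact: coord_continuous.
Qed.

Lemma rdot_ge0 v : 0 <= rdot v v.
Proof. by apply: sumr_ge0 => k _; rewrite -expr2 sqr_ge0. Qed.

Lemma rdot_le0_eq0 v : rdot v v <= 0 -> v = 0.
Proof.
move=> v0; have /eqP : rdot v v = 0 by apply/eqP; rewrite eq_le v0 rdot_ge0.
rewrite psumr_eq0 => [/allP v_eq0|k _]; last by rewrite -expr2 sqr_ge0.
apply/rowP => k; rewrite mxE; apply/eqP.
by have := v_eq0 k (mem_index_enum _); rewrite -expr2 sqrf_eq0.
Qed.

(** Comparison with the maximum norm that carries the topology of row vectors:
    it makes Euclidean balls bounded.  The summand 1 spares a square root, since
    a <= 1 + a^2. *)
Lemma norm_le_rdot v : `|v| <= 1 + rdot v v.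
Proof.
rewrite [`|v|]/Num.norm /= mx_normrE; apply/bigmax_leP; split=> [|[i k] _ /=].
  by rewrite addr_ge0 ?rdot_ge0.
rewrite ord1; have : v 0 k ^+ 2 <= rdot v v.
  rewrite /rdot (bigD1 k) //= -expr2 lerDl.
  by apply: sumr_ge0 => j _; rewrite -expr2 sqr_ge0.
rewrite -[v 0 k ^+ 2]real_normK ?num_real //; set a := `| _ |; nra.
Qed.

(** The parallelogram law, in the form that makes minimizers on convex sets
    unique. *)
Lemma rdot_midpoint u v : rdot (2^-1 *: (u + v)) (2^-1 *: (u + v)) =
  2^-1 * rdot u u + 2^-1 * rdot v v - 4^-1 * rdot (u - v) (u - v).
Proof.
rewrite /rdot !mulr_sumr -big_split /= -sumrB; apply: eq_bigr => k _.
by rewrite !mxE; field.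
Qed.

Lemma rdot_midpointl u v w :
  rdot (2^-1 *: (u + v)) w = 2^-1 * rdot u w + 2^-1 * rdot v w.
Proof.
rewrite /rdot !mulr_sumr -big_split /=; apply: eq_bigr => k _.
by rewrite !mxE; field.
Qed.

(** A minimizer exists because the points of the intersection that are no longer
    than v0 form a compact set.  It is unique because the midpoint of two
    distinct minimizers would be strictly shorter than both. *)
Lemma halfspaces_least W c v0 : (forall w, W w -> c <= rdot v0 w) ->
  exists2 q, forall w, W w -> c <= rdot q w &
    forall v, (forall w, W w -> c <= rdot v w) ->
      rdot v v <= rdot q q -> v = q.
Proof.
move=> Kv0; pose K := [set v | forall w, W w -> c <= rdot v w].
pose A := K `&` [set v | rdot v v <= rdot v0 v0].
have cdiag : continuous (fun v => rdot v v).
  by apply: continuous_rdot => v; exact: cvg_id.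
have Acompact : compact A.
  apply: bounded_closed_compact.
    exists (1 + rdot v0 v0); split; first exact: num_real.
    move=> M ltM v [_ /= lev]; apply: le_trans (norm_le_rdot v) _.
    by apply: le_trans (ltW ltM); rewrite lerD2l.
  apply: closedI; last first.
    apply: (@preimage_closed _ _ _ [set x : R | x <= rdot v0 v0]).
      by move=> v _; exact: cdiag.
    exact: closed_le.
  have -> : K = \bigcap_(w in W) [set v | c <= rdot v w].
    by apply/seteqP; split=> v Kv.
  apply: closed_bigI => w _.
  apply: (@preimage_closed _ _ (fun v => rdot v w) [set x : R | c <= x]).
    move=> v _; apply: continuous_rdot => [{}v|]; first exact: cvg_id.
    exact: cst_continuous.
  exact: closed_ge.
have [||q /set_mem[Kq qle] qmin] :=
    EVT_min_rV _ Acompact (f := fun v => rdot v v).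
- by exists v0; split=> //=.
- exact: continuous_subspaceT.
exists q => // v Kv lev.
have /qmin : 2^-1 *: (q + v) \in A.
  apply/mem_set; split=> /= [w Ww|].
    rewrite rdot_midpointl; have := Kq w Ww; have := Kv w Ww; lra.
  rewrite rdot_midpoint; move: qle lev (rdot_ge0 (q - v)) => /=; lra.
rewrite rdot_midpoint => le_mid; apply/esym/subr0_eq/rdot_le0_eq0; lra.
Qed.

End HalfSpaces.

(** * The real inner product of complex matrices *)

Section Frobenius.
Variables (R : realType) (n : nat).
Implicit Types (X Y U G : 'M[R[i]]_n) (u v : 'cV[R[i]]_n).

(** The real part of the Frobenius inner product: the Euclidean inner product
    of matrices read in real coordinates. *)
Definition frob X Y : R := complex.Re (\tr (X *m Y^t*)).

Lemma Re_mulconj (a b : R[i]) : complex.Re (a * Num.conj b) =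
  complex.Re a * complex.Re b + complex.Im a * complex.Im b.
Proof. by case: a b => [a a'] [b b'] /=; rewrite mulrN opprK. Qed.

Lemma Re_sum (I : Type) (r : seq I) (P : pred I) (F : I -> R[i]) :
  complex.Re (\sum_(k <- r | P k) F k) = \sum_(k <- r | P k) complex.Re (F k).
Proof. exact: (raddf_sum (@complex.Re R : {additive Rcomplex R -> R})). Qed.

Lemma frobE X Y : frob X Y = \sum_i \sum_j
  (complex.Re (X i j) * complex.Re (Y i j) +
   complex.Im (X i j) * complex.Im (Y i j)).
Proof.
rewrite /frob Re_sum; apply: eq_bigr => i _.
rewrite mxE Re_sum; apply: eq_bigr => j _.
by rewrite !mxE Re_mulconj.
Qed.

(** An isometry onto a Euclidean space, which transports the minimization to row
    vectors over the reals. *)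
Definition real_coords X : 'rV[R]_(n * n + n * n) :=
  row_mx (mxvec (map_mx (@complex.Re R) X)) (mxvec (map_mx (@complex.Im R) X)).

Definition of_real_coords (v : 'rV[R]_(n * n + n * n)) : 'M[R[i]]_n :=
  \matrix_(i, j) (vec_mx (lsubmx v) i j +i* vec_mx (rsubmx v) i j)%C.

Lemma real_coordsK : cancel real_coords of_real_coords.
Proof.
move=> X; apply/matrixP => i j.
by rewrite mxE row_mxKl row_mxKr !mxvecK !mxE; case: (X i j).
Qed.

Lemma of_real_coordsK : cancel of_real_coords real_coords.
Proof.
move=> v; rewrite -[RHS]hsubmxK /real_coords.
by congr row_mx; apply: (can_inj vec_mxK); rewrite mxvecK;
  apply/matrixP => i j; rewrite !mxE.
Qed.

Lemma rdot_real_coords X Y : rdot (real_coords X) (real_coords Y) = frob X Y.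
Proof.
rewrite frobE /rdot big_split_ord /=.
under eq_bigr do rewrite !row_mxEl.
under [X in _ + X]eq_bigr do rewrite !row_mxEr.
rewrite -big_split /= pair_bigA (reindex _ (curry_mxvec_bij _ _)) /=.
by apply: eq_bigr => -[i j] _; rewrite !mxvecE !mxE.
Qed.

Lemma frob_halfspaces_least (W : set 'M[R[i]]_n) (c : R) X0 :
    (forall Y, W Y -> c <= frob X0 Y) ->
  exists2 Q, forall Y, W Y -> c <= frob Q Y &
    forall X, (forall Y, W Y -> c <= frob X Y) ->
      frob X X <= frob Q Q -> X = Q.
Proof.
move=> WX0.
have [|q Wq q_least] :=
    @halfspaces_least _ _ (real_coords @` W) c (real_coords X0).
  by move=> _ [Y WY <-]; rewrite rdot_real_coords; exact: WX0.
exists (of_real_coords q) => [Y WY|X WX].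
  rewrite -rdot_real_coords of_real_coordsK; apply: Wq; exact: imageP.
rewrite -!rdot_real_coords of_real_coordsK => leX.
rewrite -[LHS]real_coordsK; congr of_real_coords; apply: q_least => //.
by move=> _ [Y WY <-]; rewrite rdot_real_coords; exact: WX.
Qed.

Lemma adjM m p q (A : 'M[R[i]]_(m, p)) (B : 'M[R[i]]_(p, q)) :
  (A *m B)^t* = B^t* *m A^t*.
Proof. by rewrite trmx_mul map_mxM. Qed.

Lemma unitary_mulVmx U : U \is unitarymx -> U^t* *m U = 1%:M.
Proof. by move=> Uu; rewrite -invmx_unitary // mulVmx ?unitarymx_unit. Qed.

Lemma frob_conj U X : U \is unitarymx ->
  frob (U *m X *m U^t*) (U *m X *m U^t*) = frob X X.
Proof.
move=> Uu; rewrite /frob !adjM trmxCK -!mulmxA (mulmxA (U^t*) U).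
rewrite unitary_mulVmx // mul1mx (mxtrace_mulC U).
by rewrite -!mulmxA unitary_mulVmx // mulmx1.
Qed.

Lemma frob_adj X : frob (X^t*) (X^t*) = frob X X.
Proof. by rewrite /frob trmxCK mxtrace_mulC. Qed.

Lemma cdot_tr u v : cdot u v = \tr (u *m v^t*).
Proof.
by rewrite cdotE; apply: eq_bigr => k _; rewrite mxE big_ord1 !mxE.
Qed.

Lemma mulmx_cdot u v : v^t* *m u = (cdot u v)%:M.
Proof.
apply/matrixP => i j; rewrite !ord1 cdotE !mxE mulr1n.
by apply: eq_bigr => k _; rewrite !mxE mulrC.
Qed.

Lemma cdot_conj u v : cdot v u = Num.conj (cdot u v).
Proof.
rewrite !cdotE rmorph_sum; apply: eq_bigr => k _.
by rewrite rmorphM /= conjCK mulrC.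
Qed.

Lemma cdot_mulmxl X u v : cdot (X *m u) v = cdot u (X^t* *m v).
Proof. by rewrite !cdot_tr adjM trmxCK -mulmxA mxtrace_mulC -mulmxA. Qed.

Lemma cdot_unitary U u v : U \is unitarymx -> cdot (U *m u) (U *m v) = cdot u v.
Proof. by move=> Uu; rewrite cdot_mulmxl mulmxA unitary_mulVmx ?mul1mx. Qed.

(** Numerical-range conditions on X are half-space conditions, with the rank
    one matrices v v^* as normal vectors. *)
Lemma frob_rank1 X v : frob X (v *m v^t*) = complex.Re (cdot (X *m v) v).
Proof. by rewrite /frob cdot_tr adjM trmxCK mulmxA. Qed.

Lemma cdot_rank1 u v : cdot (v *m v^t* *m u) u = `|cdot u v| ^+ 2.
Proof.
rewrite -mulmxA mulmx_cdot mul_mx_scalar cdot_tr -scalemxAl linearZ /=.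
by rewrite -cdot_tr (cdot_conj u v) normCK.
Qed.

End Frobenius.

(** * From an approximate fixed point to an eigenvector *)

Section InvariantOperators.
Variables (R : realType) (n : nat).
Implicit Types (Q X U G : 'M[R[i]]_n) (v : 'cV[R[i]]_n).

(** The adjoint of Q satisfies the same inequalities as Q and has the same norm,
    and so do the conjugates U Q U^* when U^* preserves V.  They are therefore
    all equal to Q, the unique least-norm solution. *)
Lemma invariant_operator (V : set 'cV[R[i]]_n) (c : R) X0 :
    (forall v, V v -> c <= complex.Re (cdot (X0 *m v) v)) ->
  exists Q, [/\ Q \is hermsymmx, frob Q Q <= frob X0 X0,
    forall v, V v -> c <= complex.Re (cdot (Q *m v) v) &
    forall U, U \is unitarymx -> (forall v, V v -> V (U^t* *m v)) ->
      U *m Q = Q *m U].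
Proof.
move=> VX0.
have [|Q VQ Q_least] :=
    @frob_halfspaces_least R n [set v *m v^t* | v in V] c X0.
  by move=> _ [v Vv <-]; rewrite frob_rank1; exact: VX0.
have {}VQ v : V v -> c <= complex.Re (cdot (Q *m v) v).
  by move=> Vv; rewrite -frob_rank1; apply: VQ; exists v.
have {}Q_least X : (forall v, V v -> c <= complex.Re (cdot (X *m v) v)) ->
    frob X X <= frob Q Q -> X = Q.
  by move=> VX; apply: Q_least => _ [v Vv <-]; rewrite frob_rank1; exact: VX.
exists Q; split=> //.
- apply/is_hermitianmxP; rewrite expr0 scale1r; apply/esym/Q_least.
    move=> v /VQ; rewrite [in X in _ -> X]cdot_mulmxl trmxCK cdot_conj.
    by case: (cdot _ _).
  by rewrite frob_adj.
- rewrite leNgt; apply/negP => lt_X0.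
  by move: (lt_X0); rewrite (Q_least X0) ?ltxx ?ltW.
- move=> U Uu VU; rewrite -[Q in RHS](Q_least (U *m Q *m U^t*)).
  + by rewrite -!mulmxA unitary_mulVmx // mulmx1.
  + move=> v Vv; rewrite -!mulmxA cdot_mulmxl; exact/VQ/VU.
  + by rewrite frob_conj.
Qed.

Definition sqmod (z : R[i]) : R := complex.Re (z * Num.conj z).

Lemma sqmodE z : sqmod z = complex.Re z ^+ 2 + complex.Im z ^+ 2.
Proof. by rewrite /sqmod Re_mulconj -!expr2. Qed.

Lemma sqmod_ge0 z : 0 <= sqmod z.
Proof. by rewrite sqmodE addr_ge0 ?sqr_ge0. Qed.

Lemma cnorm1 v : cnorm v = 1 -> cdot v v = 1.
Proof. by rewrite /cnorm => v1; rewrite -[LHS]sqrtCK v1 expr1n. Qed.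

Lemma frob_diag (d : 'rV[R[i]]_n) :
  frob (diag_mx d) (diag_mx d) = \sum_k sqmod (d 0 k).
Proof.
rewrite frobE; apply: eq_bigr => k _; rewrite (bigD1 k) //= big1 => [|j neq_jk].
  by rewrite addr0 !mxE eqxx mulr1n sqmodE.
by rewrite !mxE eq_sym (negPf neq_jk) mulr0n /= !mul0r addr0.
Qed.

Lemma Re_cdot_diag (d : 'rV[R[i]]_n) v :
  complex.Re (cdot (diag_mx d *m v) v) =
  \sum_k complex.Re (d 0 k) * sqmod (v k 0).
Proof.
rewrite cdotE Re_sum; apply: eq_bigr => k _; rewrite mul_diag_mx !mxE -mulrA.
rewrite sqmodE; case: (d 0 k) (v k 0) => [a b] [x y] /=; ring.
Qed.

(** The weights |v_k|^2 sum to 1, so the average of the Re d_k being at least c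
    forces Re d_k >= c for some k.  A second index with the same value would
    bring the sum of the |d_k|^2 to at least 2 c^2 > 1. *)
Lemma isolated_eigenvalue (c : R) (d : 'rV[R[i]]_n) v :
    1 < 2 * c ^+ 2 -> 0 <= c -> \sum_k sqmod (d 0 k) <= 1 ->
    \sum_k sqmod (v k 0) = 1 ->
    c <= \sum_k complex.Re (d 0 k) * sqmod (v k 0) ->
  exists k, forall j, j != k -> d 0 j != d 0 k.
Proof.
move=> c_large c_ge0 d_le1 v1 dv_ge.
have [[k dk]|d_lt] := pselect (exists k, c <= complex.Re (d 0 k)); last first.
  (* If every Re d_k were less than c, the terms (c - Re d_k) |v_k|^2 would be
     nonnegative with sum at most 0, so v would vanish. *)
  have gap_ge0 k : 0 <= (c - complex.Re (d 0 k)) * sqmod (v k 0).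
    rewrite mulr_ge0 ?sqmod_ge0 // subr_ge0 leNgt.
    by apply/negP => /ltW ?; apply: d_lt; exists k.
  have /eqP : \sum_k (c - complex.Re (d 0 k)) * sqmod (v k 0) = 0.
    apply/eqP; rewrite eq_le sumr_ge0 // andbT.
    under eq_bigr do rewrite mulrBl.
    by rewrite sumrB -mulr_sumr v1 mulr1 subr_le0.
  rewrite psumr_eq0 // => /allP gap0.
  have /eqP := v1; rewrite big1 ?(eq_sym 0) ?oner_eq0 // => k _.
  have := gap0 k (mem_index_enum _).
  rewrite /= mulf_eq0 subr_eq0 => /orP[|/eqP//].
  by move=> /eqP eq_c; case: d_lt; exists k; rewrite -eq_c.
exists k => j neq_jk; apply/eqP => eq_d.
have : sqmod (d 0 k) + sqmod (d 0 j) <= 1.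
  apply: le_trans d_le1; rewrite (bigD1 k) //= lerD2l (bigD1 j) //= lerDl.
  by apply: sumr_ge0 => i _; exact: sqmod_ge0.
rewrite eq_d sqmodE; have := sqr_ge0 (complex.Im (d 0 k)); nra.
Qed.

(** In the eigenbasis of Q, a matrix H that commutes with the diagonal matrix of
    the d_k satisfies d_j H_jk = H_jk d_k.  When d_k is isolated, the k-th
    column of H is zero off the diagonal, so the k-th eigenvector of Q is an
    eigenvector of everything that commutes with Q. *)
Lemma commutant_eigenvector Q (c : R) v :
    Q \is normalmx -> frob Q Q <= 1 -> 1 < 2 * c ^+ 2 -> 0 <= c ->
    cnorm v = 1 -> c <= complex.Re (cdot (Q *m v) v) ->
  exists2 eta : 'cV[R[i]]_n, cnorm eta = 1 &
    forall G, G *m Q = Q *m G -> exists lambda : R[i], G *m eta = lambda *: eta.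
Proof.
move=> /orthomx_spectralP; set U := spectralmx Q; set d := spectral_diag Q.
have Uu : U \is unitarymx by exact: spectral_unitarymx.
have UKu : U *m U^t* = 1%:M by exact/unitarymxP.
have UVu : U^t* \is unitarymx by rewrite trmxC_unitary.
rewrite invmx_unitary // => defQ Q_le1 c_large c_ge0 /cnorm1 v1 Qv_ge.
have [|||k d_simple] := @isolated_eigenvalue c d (U *m v) c_large c_ge0.
- by rewrite -frob_diag -(frob_conj _ UVu) trmxCK -defQ.
- rewrite -[RHS]/(complex.Re (1 : R[i])) -v1 -(cdot_unitary v v Uu).
  by rewrite cdotE Re_sum.
- by rewrite -Re_cdot_diag -(trmxCK U) -cdot_mulmxl trmxCK !mulmxA -defQ.
exists (U^t* *m delta_mx k 0).
  rewrite /cnorm cdot_unitary // cdotE (bigD1 k) //= big1 => [|j neq_jk].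
    by rewrite addr0 mxE !eqxx conjC1 mulr1 sqrtC1.
  by rewrite mxE (negPf neq_jk) mul0r.
move=> G comGQ; exists ((U *m G *m U^t*) k k).
have comHD : U *m G *m U^t* *m diag_mx d = diag_mx d *m (U *m G *m U^t*).
  have UQ : U *m Q = diag_mx d *m U by rewrite defQ !mulmxA UKu mul1mx.
  have QU : Q *m U^t* = U^t* *m diag_mx d by rewrite defQ -!mulmxA UKu mulmx1.
  by rewrite -mulmxA -QU mulmxA -(mulmxA U) comGQ mulmxA UQ !mulmxA.
have -> : G *m (U^t* *m delta_mx k (0 : 'I_1)) =
    U^t* *m (U *m G *m U^t* *m delta_mx k 0).
  by rewrite !mulmxA unitary_mulVmx // mul1mx.
move: (U *m G *m U^t*) comHD => H comHD.
rewrite scalemxAr; congr (_ *m _); apply/matrixP => j l.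
rewrite ord1 -colE !mxE /= eqxx andbT.
have [->|neq_jk] := eqVneq j k; first by rewrite mulr1.
have /matrixP/(_ j k) := comHD; rewrite mul_diag_mx mul_mx_diag 2!mxE => /eqP.
rewrite [H j k * _]mulrC -subr_eq0 -mulrBl mulf_eq0 subr_eq0 eq_sym.
by rewrite (negPf (d_simple _ neq_jk)) mulr0 => /eqP.
Qed.

Lemma unitary_group_adj (GG : set 'M[R[i]]_n) G :
  unitary_group GG -> GG G -> GG (G^t*).
Proof.
case=> unitaryG _ _ invG GGG; rewrite -invmx_unitary; first exact: invG.
exact: unitaryG.
Qed.

Lemma approx_fixed_eigenvector (GG : set 'M[R[i]]_n) (eps : R) v :
    unitary_group GG -> weak_approx_fixed_point eps GG v ->
    eps <= 1 -> 1 < 2 * (1 - eps) ^+ 4 ->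
  exists eta : 'cV[R[i]]_n, is_common_eigenvector GG eta.
Proof.
move=> groupG [v1 v_fix] eps_le1 eps_small; have [unitaryG G1 GM _] := groupG.
set c := (1 - eps) ^+ 2; have cv := cnorm1 v1.
(* The starting point of the minimization is the projection onto the line of v;
   its Frobenius norm is 1. *)
have [|Q [hermQ Q_le VQ comQ]] := @invariant_operator
    [set G *m v | G in GG] c (v *m v^t*).
  move=> _ [G GGG <-]; rewrite cdot_rank1 -lecR.
  have -> : ((complex.Re (`|cdot (G *m v) v| ^+ 2))%:C)%C =
      `|cdot (G *m v) v| ^+ 2.
    by apply: RRe_real; rewrite realX ?normr_real.
  rewrite /c rmorphXn /= lerXn2r ?nnegrE ?v_fix ?normr_ge0 //.
  by rewrite ler0c subr_ge0.
have [||||||eta eta1 eta_eig] := @commutant_eigenvector Q c v.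
- exact: hermitian_normalmx.
- by apply: le_trans Q_le _; rewrite frob_rank1 -mulmxA mulmx_cdot cv mulmx1 cv.
- by rewrite /c -exprM.
- exact: sqr_ge0.
- by [].
- by apply: VQ; exists 1%:M; rewrite ?mul1mx.
exists eta; split=> // G GGG; apply/eta_eig/comQ => [|_ [H GGH <-]].
  exact: unitaryG.
exists (G^t* *m H); last by rewrite mulmxA.
by apply: GM => //; exact: unitary_group_adj.
Qed.

End InvariantOperators.

Theorem corollary7p3 (R : realType) (n : nat) (eps : R)
    (eps_gt0 : 0 < eps) (n_ge2 : (2 <= n)%N)
    (eps_small : eps < 1 / (32 * n%:R))
    (GG : set 'M[R[i]]_n)
    (GG_group : unitary_group GG)
    (GG_connected : connected GG) (GG_compact : compact GG)
    (GG_fixed : exists xi : 'cV[R[i]]_n, weak_approx_fixed_point eps GG xi) :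
  exists eta : 'cV[R[i]]_n, is_common_eigenvector GG eta.
Proof.
have [xi xi_fix] := GG_fixed.
have eps_le : eps < 64^-1.
  apply: lt_le_trans eps_small _; rewrite mul1r.
  rewrite lef_pV2 ?posrE ?mulr_gt0 ?ltr0n //.
  - have : (2 : R) <= n%:R by rewrite ler_nat.
    lra.
  - exact: ltn_trans n_ge2.
apply: approx_fixed_eigenvector GG_group xi_fix _ _; first lra.
have : 15 / 16 <= (1 - eps) ^+ 2 by nra.
rewrite (exprM _ 2 2); nra.
Qed.
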